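(* Let $(\pi,\mathcal H)$ be a unitary representation of a Lie group $G$ and $v\in\mathcal H$. Then $v$ is a smooth vector if and only if the corresponding matrix coefficient $$\pi^{v,v}:G\to\mathbb{C},\qquad \pi^{v,v}(g):=\langle\pi(g)v,v\rangle,$$ is smooth on a neighborhood of the identity $\mathbf 1$ in $G$.
   Context: Lie groups are modeled on (possibly infinite-dimensional) locally convex spaces and, as a standing assumption, have a smooth exponential function $\exp_G:\mathfrak g\to G$ (i.e. for each $x\in\mathfrak g$ the curve $t\mapsto \exp_G(tx)$ is a one-parameter group with derivative $x$ at $0$). Calculus: for locally convex spaces $E,F$ and $U\subseteq E$ open, a map $f:U\to F$ is smooth if it is continuous, all iterated directional derivatives $\mathrm{d}^jf(x)(h_1,\dots,h_j)=(\partial_{h_j}\cdots\partial_{h_1}f)(x)$ exist and all maps $\mathrm{d}^jf:U\times E^j\to F$ are continuous; a Lie group is a group with a smooth manifold structure modeled on a locally convex space with smooth multiplication and inversion. A unitary representation is a homomorphism $\pi:G\to\mathrm U(\mathcal H)$ into the unitary group of a Hilbert space $\mathcal H$ (no continuity is required). A vector $v\in\mathcal H$ is smooth if the orbit map $\pi^v:G\to\mathcal H$, $g\mapsto\pi(g)v$, is smooth with respect to the norm topology on $\mathcal H$. *)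

(* Defs.v *)
From HB Require Import structures.
From mathcomp Require Import all_boot all_order all_algebra.
From mathcomp Require Import sesquilinear complex.
From mathcomp Require Import all_classical reals interval_inference convex.
From mathcomp Require Import topology normedtype.

Set Implicit Arguments.
Unset Strict Implicit.
Unset Printing Implicit Defensive.

Import Order.TTheory GRing.Theory Num.Theory.
Import numFieldTopology.Exports numFieldNormedType.Exports.

Local Open Scope classical_set_scope.
Local Open Scope ring_scope.
Local Open Scope complex_scope.

Section calculus.
Context {R : realType} {E F : tvsType R}.
Implicit Types (f : E -> F) (U : set E) (h x : E).

Definition is_dirder f h x (l : F) :=
  (fun t : R => t^-1 *: (f (x + t *: h) - f x)) @ 0^' --> l.

(* Unambiguous when [F] is Hausdorff, which [tvsType] does not require; otherwise
   some limit is chosen. The value is 0 where there is no limit. *)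
Definition dirder f h x : F := xget 0 [set l | is_dirder f h x l].

(* The head of [hs] is the direction of the innermost derivative. *)
Definition dirders f (hs : seq E) : E -> F := foldl dirder f hs.

(* Meant for open [U], on which the values of [f] outside [U] are irrelevant.
   The case [j = 0] of the second clause is the continuity of [f]. *)
Definition smooth_on U f :=
  (forall (hs : seq E) h x, U x -> exists l, is_dirder (dirders f hs) h x l) /\
  (forall j : nat, {in U `*` [set: 'rV[E]_j],
     continuous (fun p : E * 'rV[E]_j =>
       dirders f [seq p.2 0 i | i <- enum 'I_j] p.1)}).

End calculus.

(* A complex locally convex space as a real one, by restriction of scalars along
   the embedding of [R] in [R[i]]: smoothness only involves real parameters. *)

Definition realified (R : realType) (V : Type) : Type := V.

Section realified_tvs.
Context {R : realType} {V : tvsType R[i]}.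
Local Notation VR := (realified R V).
Implicit Types (a b : R) (u v : VR).

HB.instance Definition _ := Uniform.on VR.
HB.instance Definition _ := GRing.Zmodule.on VR.

Definition real_scale a u : VR := a%:C *: (u : V).

Let real_scaleA a b u : real_scale a (real_scale b u) = real_scale (a * b) u.
Proof. by rewrite /real_scale scalerA rmorphM. Qed.

Let real_scale1 : left_id 1 real_scale.
Proof. by move=> u; rewrite /real_scale rmorph1 scale1r. Qed.

Let real_scaleDr : right_distributive real_scale +%R.
Proof. by move=> a u v; rewrite /real_scale scalerDr. Qed.

Let real_scaleDl u : {morph real_scale^~ u : a b / a + b}.
Proof. by move=> a b; rewrite /real_scale rmorphD scalerDl. Qed.

HB.instance Definition _ := GRing.Zmodule_isLmodule.Build R VR
  real_scaleA real_scale1 real_scaleDr real_scaleDl.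

Let real_add_continuous : continuous (fun x : VR * VR => x.1 + x.2).
Proof. exact: (@add_continuous V). Qed.

Let real_complex_continuous : continuous (real_complex R : R -> R[i]^o).
Proof.
move=> a; apply/cvgrPdist_lt => -[e e'] /=; rewrite ltcE/= => /andP[/eqP -> e0].
near=> b; rewrite -rmorphB normc_def/= expr0n/= addr0 sqrtr_sqr ltcR.
by near: b; exact: (@cvgr_dist_lt R R _ (nbhs a) _ id a cvg_id).
Unshelve. all: by end_near. Qed.

Let real_scale_continuous : continuous (fun z : R^o * VR => z.1 *: z.2).
Proof.
move=> [a u].
apply: (@continuous_comp _ _ _ (fun z : R^o * VR => (z.1%:C, z.2) : R[i]^o * V)
  (fun z : R[i]^o * V => z.1 *: z.2)); last exact: scale_continuous.
apply: (@cvg_pair _ _ _ _ (nbhs (a%:C : R[i]^o)) (nbhs (u : V))) => /=.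
  by apply: (cvg_comp _ _ cvg_fst); exact: real_complex_continuous.
exact: cvg_snd.
Qed.

Let real_locally_convex :
  exists2 B : set_system VR, (forall A, A \in B -> convex_set A) & basis B.
Proof.
have [B Bc Bb] := @locally_convex R[i] V.
exists B => // A /Bc Ac u v l uA vA.
have l0 : 0 <= l%:num%:C by rewrite lecR.
have l1 : l%:num%:C <= 1 by rewrite lecR.
have /= := Ac u v (Itv01 l0 l1) uA vA.
rewrite [X in X \in A](_ : _ =
  l%:num%:C *: (u : V) + (1 - l%:num%:C) *: (v : V))//.
by rewrite -[X in X - _](rmorph1 (real_complex R)) -rmorphB.
Qed.

HB.instance Definition _ := PreTopologicalNmodule_isTopologicalNmodule.Build
  VR real_add_continuous.
HB.instance Definition _ := TopologicalNmodule_isTopologicalLmodule.Build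
  R VR real_scale_continuous.
HB.instance Definition _ := Uniform_isTvs.Build R VR real_locally_convex.

End realified_tvs.

Record chart (R : realType) (E : tvsType R) (M : topologicalType) := Chart {
  chart_dom : set M ;
  chart_map :> M -> E ;
  chart_inv : E -> M ;
  open_chart_dom : open chart_dom ;
  open_chart_img : open (chart_map @` chart_dom) ;
  chart_mapK : {in chart_dom, cancel chart_map chart_inv} ;
  chart_map_continuous : {in chart_dom, continuous chart_map} ;
  chart_inv_continuous : {in chart_map @` chart_dom, continuous chart_inv}
}.

Section manifolds.
Context {R : realType}.

Definition smooth_atlas (E : tvsType R) (M : topologicalType)
    (A : set (chart E M)) :=
  (forall x, exists2 c, A c & chart_dom c x) /\
  (forall c d, A c -> A d ->
    smooth_on (c @` (chart_dom c `&` chart_dom d)) (d \o chart_inv c)).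

Definition smooth_map_on (E F : tvsType R) (M N : topologicalType)
    (A : set (chart E M)) (B : set (chart F N)) (U : set M) (f : M -> N) :=
  {in U, continuous f} /\
  (forall c d, A c -> B d ->
    smooth_on (c @` (U `&` chart_dom c `&` f @^-1` chart_dom d))
      (d \o f \o chart_inv c)).

Section id_chart.
Variable E : tvsType R.

Let open_img : open (id @` [set: E]).
Proof. by rewrite image_id; exact: openT. Qed.

Let id_continuous (A : set E) : {in A, continuous (@id E)}.
Proof. by move=> x _; exact: cvg_id. Qed.

Definition id_chart : chart E E :=
  Chart openT open_img (fun x _ => erefl) (@id_continuous _) (@id_continuous _).

End id_chart.

Definition id_atlas (E : tvsType R) : set (chart E E) := [set id_chart E].

Section products.
Context {E F : tvsType R} {M N : topologicalType}.

Section prod_chart.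
Variables (c : chart E M) (d : chart F N).

Let dom := chart_dom c `*` chart_dom d.
Let map (x : M * N) : E * F := (c x.1, d x.2).
Let inv (y : E * F) : M * N := (chart_inv c y.1, chart_inv d y.2).

Let open_prod (S T : topologicalType) (A : set S) (B : set T) :
  open A -> open B -> open (A `*` B).
Proof.
rewrite !openE => oA oB [x y] [/= /oA Ax /oB By].
by exists (A, B).
Qed.

Let mapE : map @` dom = (c @` chart_dom c) `*` (d @` chart_dom d).
Proof.
apply/seteqP; split=> [_ [[x y] [/= cx dy] <-]|[_ _] [/= [x cx <-] [y dy <-]]].
  by split; [exists x|exists y].
by exists (x, y).
Qed.

Let open_dom : open dom.
Proof. by apply: open_prod; exact: open_chart_dom. Qed.

Let open_img : open (map @` dom).
Proof. by rewrite mapE; apply: open_prod; exact: open_chart_img. Qed.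

Let mapK : {in dom, cancel map inv}.
Proof.
move=> [x y] /set_mem[/= cx dy].
by rewrite /inv /map/= !chart_mapK//; exact: mem_set.
Qed.

Let continuous_prod (S T S' T' : topologicalType) (f : S -> S') (g : T -> T')
    (A : set S) (B : set T) :
  {in A, continuous f} -> {in B, continuous g} ->
  {in A `*` B, continuous (fun x => (f x.1, g x.2))}.
Proof.
move=> fA gB [x y] /set_mem[/= Ax By].
apply: cvg_pair => /=.
  by apply: (cvg_comp _ _ cvg_fst); apply: fA; exact: mem_set.
by apply: (cvg_comp _ _ cvg_snd); apply: gB; exact: mem_set.
Qed.

Let map_continuous : {in dom, continuous map}.
Proof. by apply: continuous_prod; exact: chart_map_continuous. Qed.

Let inv_continuous : {in map @` dom, continuous inv}.
Proof.
by rewrite mapE; apply: continuous_prod; exact: chart_inv_continuous.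
Qed.

Definition prod_chart : chart (E * F)%type (M * N)%type :=
  Chart open_dom open_img mapK map_continuous inv_continuous.

End prod_chart.

Definition prod_atlas (A : set (chart E M)) (B : set (chart F N)) :
    set (chart (E * F)%type (M * N)%type) :=
  [set prod_chart c d | c in A & d in B].

End products.

End manifolds.

Arguments id_atlas {R} E _.

HB.mixin Record Group_isLie (R : realType) (E : tvsType R) G
    of Topological G & Group G := {
  lie_atlas : set (chart E G) ;
  lie_atlas_smooth : smooth_atlas lie_atlas ;
  lie_mul_smooth : smooth_map_on (prod_atlas lie_atlas lie_atlas) lie_atlas
    setT (fun p : G * G => (p.1 * p.2)%g) ;
  lie_inv_smooth : smooth_map_on lie_atlas lie_atlas setT (fun g : G => g^-1%g)
}.

#[short(type="lieGroupType")]
HB.structure Definition LieGroup (R : realType) (E : tvsType R) :=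
  {G of Topological G & Group G & Group_isLie R E G}.

(* A chart [c] at the identity identifies the Lie algebra, i.e., the tangent
   space at the identity, with the model space [E]. *)
Definition has_smooth_exp (R : realType) (E : tvsType R)
    (G : lieGroupType E) :=
  exists2 c : chart E G, lie_atlas c /\ chart_dom c 1%g &
  exists exp : E -> G,
    [/\ smooth_map_on (id_atlas E) lie_atlas setT exp,
        forall (x : E) (s t : R),
          exp ((s + t) *: x) = (exp (s *: x) * exp (t *: x))%g &
        forall x : E, is_dirder (c \o exp) x 0 x].

HB.mixin Record CompleteNormedModule_isHilbert (R : realType) H
    of CompleteNormedModule R[i] H := {
  inner : {dot H for (@Num.conj R[i])} ;
  inner_norm : forall u : H, inner u u = `|u| ^+ 2
}.

#[short(type="hilbertType")]
HB.structure Definition Hilbert (R : realType) :=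
  {H of CompleteNormedModule R[i] H & CompleteNormedModule_isHilbert R H}.

Definition is_unitary (R : realType) (H : hilbertType R)
    (u : {linear H -> H}) :=
  bijective u /\ forall v w, inner (u v) (u w) = inner v w.

Record unitary_rep (R : realType) (G : groupType) (H : hilbertType R) := {
  rep :> G -> {linear H -> H} ;
  rep_unitary : forall g, is_unitary (rep g) ;
  repM : forall g h, rep (g * h)%g =1 rep g \o rep h
}.

Section smooth_vectors.
Context {R : realType} {E : tvsType R} {G : lieGroupType E} {H : hilbertType R}.
Variable pi : unitary_rep G H.

Definition orbit_map (v : H) : G -> realified R H := fun g => pi g v.

Definition matrix_coef (v w : H) : G -> realified R R[i]^o :=
  fun g => inner (pi g v) w.

Definition smooth_vector (v : H) :=
  smooth_map_on lie_atlas (id_atlas _) setT (orbit_map v).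

End smooth_vectors.

(* Main.v *)
(* The real inner product gives a kernel Re <pi(g)v, pi(h)v> = Re phi(h^-1 g),
   where phi is the matrix coefficient of v. If phi is smooth near the identity,
   this kernel is smooth near the diagonal of G x G by the chain rule. A map g
   into a Hilbert space with a smooth kernel K(x,y) = <g(x), g(y)> is smooth:
   difference quotients of g are Cauchy, since their inner products are mixed
   difference quotients of K and hence converge to a mixed derivative of K on
   the diagonal; moreover the kernel of each iterated derivative of g is an
   iterated derivative of K, so that the argument can be iterated and also
   yields joint continuity in the point and the directions. The chain rule is
   only needed for scalar functions of a map into a locally convex space, where
   the mean value theorem for real functions suffices. *)
Require Import Defs.
From HB Require Import structures.
From mathcomp Require Import all_boot all_order all_algebra.
From mathcomp Require Import sesquilinear complex.
From mathcomp Require Import all_classical reals topology normedtype.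
From mathcomp Require Import derive ring lra.

Set Implicit Arguments.
Unset Strict Implicit.
Unset Printing Implicit Defensive.

Import Order.TTheory GRing.Theory Num.Theory.
Import numFieldTopology.Exports numFieldNormedType.Exports.

Local Open Scope classical_set_scope.
Local Open Scope ring_scope.
Local Open Scope complex_scope.

(** * Limits in topological vector spaces along arbitrary filters *)

Lemma cvg_near_eq (T : Type) (S : topologicalType) (Q : set_system T)
    (FQ : Filter Q) (f g : T -> S) (l : S) :
  f @ Q --> l -> (\forall t \near Q, f t = g t) -> g @ Q --> l.
Proof. by move=> fl fg; apply: cvg_trans fl; exact: near_eq_cvg. Qed.

Section tvs_limits.
Context {R : realType} {E : tvsType R} {T : Type} {Q : set_system T}.
Context {FQ : Filter Q}.

Lemma tvs_cvgD (f g : T -> E) (x y : E) : f @ Q --> x -> g @ Q --> y ->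
  f t + g t @[t --> Q] --> x + y.
Proof.
move=> fx gy.
apply: (cvg_comp (fun t => (f t, g t)) (fun z : E * E => z.1 + z.2)).
  exact: (cvg_pair fx gy).
exact: (@add_continuous E (x, y)).
Qed.

Lemma tvs_cvgZ (s : T -> R) (f : T -> E) (a : R) (x : E) :
  s @ Q --> a -> f @ Q --> x -> s t *: f t @[t --> Q] --> a *: x.
Proof.
move=> sa fx.
apply: (cvg_comp (fun t => (s t : R^o, f t)) (fun z : R^o * E => z.1 *: z.2)).
  exact: (cvg_pair sa fx).
exact: (@scale_continuous R E (a, x)).
Qed.

Lemma tvs_cvgB (f g : T -> E) (x y : E) : f @ Q --> x -> g @ Q --> y ->
  f t - g t @[t --> Q] --> x - y.
Proof.
move=> fx gy; rewrite -[- y]scaleN1r.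
under eq_fun do rewrite -[- g _]scaleN1r.
by apply: tvs_cvgD => //; apply: tvs_cvgZ => //; exact: cvg_cst.
Qed.

Lemma tvs_cvg_sum (J : Type) (s : seq J) (f : J -> T -> E) (l : J -> E) :
  (forall j, f j @ Q --> l j) ->
  \sum_(j <- s) f j t @[t --> Q] --> \sum_(j <- s) l j.
Proof.
move=> fl; elim: s => [|j s IH].
  by rewrite big_nil; under eq_fun do rewrite big_nil; exact: cvg_cst.
rewrite big_cons; under eq_fun do rewrite big_cons.
exact: tvs_cvgD.
Qed.

Lemma tvs_cvg_line (y q : T -> E) (r : T -> R) (y0 q0 : E) :
  y @ Q --> y0 -> q @ Q --> q0 -> r @ Q --> (0 : R) ->
  y t + r t *: q t @[t --> Q] --> y0.
Proof.
move=> yy0 qq0 r0; rewrite -[X in _ --> X]addr0 -[X in _ + X](scale0r q0).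
by apply: tvs_cvgD => //; exact: tvs_cvgZ.
Qed.

End tvs_limits.

Lemma cvg_mx (T : topologicalType) (m n : nat) (I : Type) (Q : set_system I)
    (FQ : Filter Q) (f : I -> 'M[T]_(m, n)) (M : 'M[T]_(m, n)) :
  (forall i j, f t i j @[t --> Q] --> M i j) -> f @ Q --> M.
Proof.
move=> fM A [P PM PA]; rewrite nbhs_simpl /=.
have : \forall t \near Q, forall i j, P i j (f t i j).
  apply: filter_forall => i.
  by apply: filter_forall => j; exact: fM (PM i j).
by apply: filterS => t Pt; exact: PA.
Qed.

Lemma mx_coord_continuous (T : topologicalType) (m n : nat) i j :
  continuous (fun M : 'M[T]_(m, n) => M i j).
Proof.
move=> M A AM; exists (fun i' j' => if (i' == i) && (j' == j) then A else setT).
  by move=> i' j'; case: ifPn => [/andP[/eqP-> /eqP->]//|_]; exact: filterT.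
by move=> N /(_ i j); rewrite !eqxx.
Qed.

Lemma dnbhs_cvg_line (R : realType) (E : tvsType R) (x h : E) :
  (fun t : R => x + t *: h) @ (0 : R)^' --> x.
Proof.
by apply: (tvs_cvg_line (cvg_cst x) (cvg_cst h)); exact: cvg_within.
Qed.

Lemma near_cvg_line (R : realType) (E : tvsType R) (U : set E) (x h : E) :
  open U -> U x -> \forall t \near (0 : R)^', U (x + t *: h).
Proof.
move=> oU Ux; have := @dnbhs_cvg_line R E x h.
by apply; exact: open_nbhs_nbhs.
Qed.

(** * Families of iterated directional derivatives *)

Section smooth_families.
Context {R : realType}.
Implicit Types E F : tvsType R.

(* [D hs] plays the role of the iterated derivative along [hs]. Keeping the
   family as data avoids the choice of limits in [dirders], which is not
   canonical (nor stable under products) when the target is not Hausdorff. *)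
Definition smooth_family E F (U : set E) (D : seq E -> E -> F) :=
  (forall hs h x, U x -> is_dirder (D hs) h x (D (rcons hs h) x)) /\
  (forall (I T : Type) (Q : set_system T) (s : seq I) (k : I -> T -> E)
      (k0 : I -> E) (a : T -> E) x,
    Filter Q -> U x -> a @ Q --> x -> (forall i, k i @ Q --> k0 i) ->
    D [seq k i t | i <- s] (a t) @[t --> Q] --> D [seq k0 i | i <- s] x).

Lemma is_dirder_near E F (f g : E -> F) h x l :
  f x = g x -> (\forall t \near (0 : R)^', f (x + t *: h) = g (x + t *: h)) ->
  is_dirder f h x l -> is_dirder g h x l.
Proof.
move=> fgx fg; apply: cvg_trans; apply: near_eq_cvg.
by near=> t; rewrite fgx; congr (_ *: (_ - _)); near: t.
Unshelve. all: by end_near. Qed.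

Lemma is_dirder_unique E F (f : E -> F) h x l l' :
  hausdorff_space F -> is_dirder f h x l -> is_dirder f h x l' -> l = l'.
Proof. by move=> hF; apply: cvg_unique. Qed.

(** Smoothness tests continuity on row vectors; directions moving along a filter are packed into
    such a row, indexed by their positions in the list. *)
Lemma smooth_on_family E F (U : set E) (f : E -> F) :
  smooth_on U f -> smooth_family U (dirders f).
Proof.
move=> [fd fc]; split=> [hs h x Ux|I T Q s k k0 a x FQ Ux ax kk0].
  rewrite /dirders foldl_rcons -/(dirders f hs) /dirder.
  by have /(xgetPex 0) := fd hs h x Ux.
have fcvg (j : nat) (b : T -> 'rV[E]_j) (b0 : 'rV[E]_j) : b @ Q --> b0 ->
    dirders f [seq b t 0 i | i <- enum 'I_j] (a t) @[t --> Q] -->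
    dirders f [seq b0 0 i | i <- enum 'I_j] x.
  move=> bb0; apply: (cvg_comp (fun t => (a t, b t)) (fun p : E * 'rV[E]_j =>
       dirders f [seq p.2 0 i | i <- enum 'I_j] p.1)).
    exact: (cvg_pair ax bb0).
  by apply: (fc j (x, b0)); rewrite inE.
(* The head serves as the default value of [nth], so the empty list is treated apart. *)
case: s => [|i0 s'].
  have /= := fcvg 0 (fun=> 0) 0 (cvg_cst _).
  by rewrite enum_ord0; exact.
set s := i0 :: s'; pose nk i := nth i0 s i.
pose b t : 'rV[E]_(size s) := \row_i k (nk i) t.
pose b0 : 'rV[E]_(size s) := \row_i k0 (nk i).
have bb0 : b @ Q --> b0.
  apply: cvg_mx => i j; rewrite /b0 mxE.
  by under eq_fun do rewrite mxE; exact: kk0.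
have enumE (g : I -> E) :
    [seq (\row_i g (nk i) : 'rV[E]_(size s)) 0 i | i <- enum 'I_(size s)] =
    [seq g i | i <- s].
  under eq_map do rewrite mxE.
  rewrite (map_comp g (fun i : 'I_(size s) => nk i)); congr map.
  by rewrite (map_comp (nth i0 s) val) val_enum_ord -/(mkseq _ _) mkseq_nth.
rewrite -enumE; under eq_fun do rewrite -(enumE (k^~ _)).
exact: fcvg.
Qed.

(** Limits in a Hausdorff space are unique, so [D] and [dirders f] agree on [U] by induction on the
    order; as [U] is open, they agree along the short lines that define the next derivative. *)
Lemma family_smooth_on E F (U : set E) (f : E -> F) (D : seq E -> E -> F) :
  open U -> hausdorff_space F -> (forall x, U x -> D [::] x = f x) ->
  smooth_family U D -> smooth_on U f.
Proof.
move=> oU hF D0 [Dd Dc].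
have DE hs x : U x -> D hs x = dirders f hs x.
  elim/last_ind: hs x => [|hs h IH] x Ux; first exact: D0.
  rewrite /dirders foldl_rcons -/(dirders f hs) /dirder.
  have H : is_dirder (dirders f hs) h x (D (rcons hs h) x).
    apply: is_dirder_near (Dd hs h x Ux); first exact: IH.
    by have := near_cvg_line h oU Ux; apply: filterS => t; exact: IH.
  apply: (is_dirder_unique hF H).
  have /(xgetPex 0) // : exists l, is_dirder (dirders f hs) h x l.
  by exists (D (rcons hs h) x).
split=> [hs h x Ux|j [x b]].
  exists (D (rcons hs h) x); apply: is_dirder_near (Dd hs h x Ux).
    exact: DE.
  by have := near_cvg_line h oU Ux; apply: filterS => t; exact: DE.
rewrite inE => -[/= Ux _].
rewrite /continuous_at/= -DE//.
have := Dc 'I_j (E * 'rV[E]_j)%type (nbhs (x, b)) (enum 'I_j)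
  (fun i p => p.2 0 i) (b 0) fst x _ Ux cvg_fst.
have H : forall i, (fun p : E * 'rV[E]_j => p.2 0 i) @ nbhs (x, b) --> b 0 i.
  move=> i; apply: (cvg_comp snd (fun M : 'rV[E]_j => M 0 i)).
    exact: (@cvg_snd _ _ (nbhs x) (nbhs b)).
  exact: mx_coord_continuous.
move=> /(_ _ _ H); apply: cvg_trans; apply: near_eq_cvg.
have : \forall p \near (x, b), U p.1.
  by apply: cvg_fst; exact: open_nbhs_nbhs.
by apply: filterS => -[y c] /= Uy; rewrite DE.
Qed.

Lemma is_dirder_linear E F F' (f : E -> F) (L : F -> F') h x l :
  linear L -> continuous L -> is_dirder f h x l -> is_dirder (L \o f) h x (L l).
Proof.
move=> lL cL fl.
have LB u w : L (u - w) = L u - L w.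
  by rewrite addrC -scaleN1r lL scaleN1r addrC.
have L0 : L 0 = 0 by have := LB 0 0; rewrite !subrr.
have LZ c u : L (c *: u) = c *: L u by rewrite -[c *: u]addr0 lL L0 addr0.
rewrite /is_dirder [X in X @ _](_ : _ =
    L \o (fun t : R => t^-1 *: (f (x + t *: h) - f x))).
  exact: (cvg_comp _ _ fl (cL _)).
by apply/funext => t /=; rewrite LZ LB.
Qed.

Lemma smooth_family_linear E F F' (U : set E) (D : seq E -> E -> F)
    (L : F -> F') :
  linear L -> continuous L -> smooth_family U D ->
  smooth_family U (fun hs => L \o D hs).
Proof.
move=> lL cL [Dd Dc]; split=> [hs h x Ux|I T Q s k k0 a x FQ Ux ax kk0].
  exact: is_dirder_linear (Dd _ _ _ Ux).
exact: (cvg_comp _ _ (Dc _ _ _ s _ _ _ _ FQ Ux ax kk0) (cL _)).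
Qed.

End smooth_families.

(** * Rules for directional derivatives *)

Section directional_derivatives.
Context {R : realType} {E F : tvsType R}.
Implicit Types f g : E -> F.

Lemma is_dirderZ f h x l (c : R) :
  is_dirder f h x l -> is_dirder f (c *: h) x (c *: l).
Proof.
(* Substituting [t * c] for [t] preserves punctured neighborhoods of 0 only if [c] is nonzero; for
   [c = 0] the quotient is constantly 0. *)
have [->|c0] := eqVneq c 0 => fl.
  rewrite /is_dirder !scale0r.
  under eq_fun do rewrite scaler0 addr0 subrr scaler0.
  exact: cvg_cst.
have c0' : ( *%R^~ c : R -> R) @ (0 : R)^' --> (0 : R)^'.
  have cc : ( *%R^~ c : R -> R) @ (0 : R) --> (0 : R).
    rewrite -[X in _ --> X](mul0r c).
    by apply: cvgM; [exact: cvg_id|exact: cvg_cst].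
  move=> A /cc A0; apply: (@filterS _ (nbhs (0 : R))) A0 => t /= tA t0.
  by apply: tA; rewrite mulf_neq0.
rewrite /is_dirder; apply: cvg_near_eq.
  exact: (tvs_cvgZ (cvg_cst c) (cvg_comp _ _ c0' fl)).
by near=> t; rewrite /= !scalerA invfM mulrCA divff// mulr1.
Unshelve. all: by end_near. Qed.

Lemma is_dirderD f g h x l l' : is_dirder f h x l -> is_dirder g h x l' ->
  is_dirder (fun y => f y + g y) h x (l + l').
Proof.
move=> fl gl; apply: cvg_near_eq; first exact: (tvs_cvgD fl gl).
by near=> t; rewrite -scalerDr opprD addrACA.
Unshelve. all: by end_near. Qed.

Lemma is_dirder_sum (J : Type) (s : seq J) (f : J -> E -> F) h x l :
  (forall j, is_dirder (f j) h x (l j)) ->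
  is_dirder (fun y => \sum_(j <- s) f j y) h x (\sum_(j <- s) l j).
Proof.
move=> fl; have H := @tvs_cvg_sum R F R (0 : R)^' _ J s
  (fun j (t : R) => t^-1 *: (f j (x + t *: h) - f j x)) l fl.
apply: cvg_near_eq; first exact: H.
by near=> t; rewrite -scaler_sumr sumrB.
Unshelve. all: by end_near. Qed.

Lemma is_dirder_scaler f h x l (c : R) : is_dirder f h x l ->
  is_dirder (fun y => c *: f y) h x (c *: l).
Proof.
move=> fl; apply: cvg_near_eq; first exact: (tvs_cvgZ (cvg_cst c) fl).
by near=> t; rewrite -scalerBr !scalerA mulrC.
Unshelve. all: by end_near. Qed.

End directional_derivatives.

(** * Mean value theorem and multilinearity of scalar derivatives *)

Section scalar_families.
Context {R : realType} {E : tvsType R}.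

Lemma dir_MVT (f : E -> R^o) (f' : R -> R) (x h : E) :
  (forall s : R, 0 <= s <= 1 -> is_dirder f h (x + s *: h) (f' s)) ->
  exists2 s : R, 0 <= s <= 1 & f (x + h) - f x = f' s.
Proof.
move=> ff'; pose u (s : R) : R := f (x + s *: h).
have du (s : R) : 0 <= s <= 1 -> is_derive s 1 u (f' s).
  move=> s01; have := ff' s s01.
  rewrite /is_dirder [X in X @ _](_ : _ =
    (fun r : R => r^-1 *: ((u \o shift s) (r *: 1) - u s))).
    by move=> H; split; [apply/cvg_ex; exists (f' s)|exact: cvg_lim].
  apply/funext => r /=.
  by rewrite /u /shift/= [r *: 1]mulr1 -addrA -scalerDl [s + r]addrC.
have [//| | |s s01] := @MVT _ u f' 0 1.
- by move=> s /[!in_itv]/= /andP[s0 s1]; apply: du; rewrite !ltW.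
- apply: derivable_within_continuous => s /[!in_itv]/= s01.
  by have [] := du s s01.
rewrite /u scale1r scale0r addr0 subr0 mulr1 => uE.
by exists s => //; move: s01; rewrite in_itv/= => /andP[? ?]; rewrite !ltW.
Qed.

(** The points [y t + a *: q t] tend to [y0] as [a] tends to 0, and [a = s * r t] is small uniformly
    in [s]; hence whole segments eventually lie in [V]. *)
Lemma near_segment (T : Type) (Q : set_system T) (FQ : Filter Q) (V : set E)
    (y q : T -> E) (r : T -> R) (y0 q0 : E) :
  open V -> V y0 -> y @ Q --> y0 -> q @ Q --> q0 -> r @ Q --> (0 : R) ->
  \forall t \near Q, forall s : R, 0 <= s <= 1 -> V (y t + s *: (r t *: q t)).
Proof.
move=> oV Vy0 yy0 qq0 r0.
have : (fun p : T * R => y p.1 + p.2 *: q p.1) @ (Q, nbhs (0 : R)) --> y0.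
  apply: (tvs_cvg_line _ (cvg_comp _ _ cvg_fst qq0)); last exact: cvg_snd.
  exact: cvg_comp cvg_fst yy0.
move=> /(_ V (open_nbhs_nbhs (conj oV Vy0))) [[A B]/= [QA]].
move=> /nbhs_ballP[e /= e0 eB] ABV.
have re : \forall t \near Q, `|r t| < e.
  have /cvgrPdist_lt/(_ e e0) := r0.
  by apply: filterS => t; rewrite sub0r normrN.
apply: filterS2 QA re => t At re s /andP[s0 s1].
rewrite scalerA; apply: (ABV (t, _)); split => //=; apply: eB.
rewrite /ball/= sub0r normrN normrM ger0_norm//.
by apply: le_lt_trans re; rewrite ler_piMl.
Qed.

Context {V : set E} {D : seq E -> E -> R^o}.
Hypotheses (oV : open V) (VD : smooth_family V D).

(** Strict differentiability: base point, directions and increment all move. The mean value theorem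
    turns the quotient into a derivative at an intermediate point, and joint continuity gives the
    limit. *)
Lemma family_strict (I T : Type) (Q : set_system T) (s : seq I)
    (k : I -> T -> E) (k0 : I -> E) (y q : T -> E) (r : T -> R) y0 q0 :
  Filter Q -> V y0 -> y @ Q --> y0 -> q @ Q --> q0 ->
  (forall i, k i @ Q --> k0 i) -> r @ Q --> (0 : R) ->
  (\forall t \near Q, r t != 0) ->
  (r t)^-1 *: (D [seq k i t | i <- s] (y t + r t *: q t) -
               D [seq k i t | i <- s] (y t)) @[t --> Q] -->
  D (rcons [seq k0 i | i <- s] q0) y0.
Proof.
move=> FQ Vy0 yy0 qq0 kk0 r0 rn0; have [Dd Dc] := VD.
(* The equation is conditional on the segment lying in [V], so that an intermediate parameter can be
   chosen for every [t], with 0 as default. *)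
pose P (t : T) (z : R) := 0 <= z <= 1 /\
  ((forall s : R, 0 <= s <= 1 -> V (y t + s *: (r t *: q t))) ->
  D [seq k i t | i <- s] (y t + r t *: q t) - D [seq k i t | i <- s] (y t) =
  r t * D (rcons [seq k i t | i <- s] (q t)) (y t + z *: (r t *: q t))).
have [|sg sgP] := @choice _ _ P.
  move=> t; have [Vt|nVt] := pselect (forall s : R, 0 <= s <= 1 ->
      V (y t + s *: (r t *: q t))); last first.
    by exists 0; split=> //; rewrite lexx ler01.
  have [z z01 zE] := @dir_MVT (D [seq k i t | i <- s]) (fun z => r t *
      D (rcons [seq k i t | i <- s] (q t)) (y t + z *: (r t *: q t)))
      (y t) (r t *: q t) (fun z z01 => is_dirderZ (Dd _ _ _ (Vt z z01))).
  by exists z.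
have sgr0 : (fun t => sg t * r t) @ Q --> (0 : R).
  apply/cvgr0Pnorm_lt => e e0; have /cvgr0Pnorm_lt/(_ e e0) := r0.
  apply: filterS => t; apply: le_lt_trans; have [/andP[? ?] _] := sgP t.
  by rewrite normrM ger0_norm// ler_piMl.
have ysg : (fun t => y t + sg t *: (r t *: q t)) @ Q --> y0.
  by under eq_fun do rewrite scalerA; exact: (tvs_cvg_line yy0 qq0).
(* The index [None] stands for the additional last direction [q]. *)
have := Dc (option I) T Q (rcons [seq Some i | i <- s] None)
  (fun i => if i is Some i then k i else q)
  (fun i => if i is Some i then k0 i else q0) _ _ FQ Vy0 ysg.
rewrite map_rcons -map_comp/=.
under eq_fun do rewrite map_rcons -map_comp/=.
move=> H; apply: cvg_near_eq; first by apply: H; case.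
have := near_segment FQ oV Vy0 yy0 qq0 r0.
apply: filterS2 rn0 => t rt0 Vt.
by rewrite (sgP t).2// /GRing.scale/= mulKf.
Qed.

Lemma is_dirder_hausdorff (f : E -> R^o) h x l l' :
  is_dirder f h x l -> is_dirder f h x l' -> l = l'.
Proof. exact/is_dirder_unique/Rhausdorff. Qed.

(** Homogeneity is a change of parameter. For additivity, go from [y] to [y + t *: w] and then on by
    [t *: u]; the second move starts at a moving point, which strict differentiability allows. *)
Lemma family_linear_last hs (c : R) a b y : V y ->
  D (rcons hs (c *: a + b)) y = c *: D (rcons hs a) y + D (rcons hs b) y.
Proof.
move=> Vy; have [Dd Dc] := VD.
have DZ : D (rcons hs (c *: a)) y = c *: D (rcons hs a) y.
  apply: is_dirder_hausdorff (Dd _ _ _ Vy) _; exact/is_dirderZ/Dd.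
have D_D u w : D (rcons hs (u + w)) y = D (rcons hs u) y + D (rcons hs w) y.
  apply: is_dirder_hausdorff (Dd _ _ _ Vy) _.
  have := @family_strict E R (0 : R)^' hs (fun i _ => i) id _ (fun=> u) id y u
    _ Vy (@dnbhs_cvg_line _ _ y w) (cvg_cst _) (fun _ => cvg_cst _)
    (@cvg_within _ _ _ _) (nbhs_dnbhs_neq _).
  rewrite !map_id => /(_ _ _ _ _) H; apply: cvg_near_eq.
    exact: (tvs_cvgD H (Dd hs w y Vy)).
  near=> t.
  rewrite -scalerDr; congr (_ *: _).
  by rewrite addrA subrK scalerDr [_ *: u + _]addrC addrA.
by rewrite D_D DZ.
Unshelve. all: by end_near. Qed.

(** By induction on the directions after the slot: an identity that holds throughout the open set
    [V] can be differentiated. *)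
Lemma family_linear hs1 hs2 (c : R) a b y : V y ->
  D (hs1 ++ (c *: a + b) :: hs2) y =
  c *: D (hs1 ++ a :: hs2) y + D (hs1 ++ b :: hs2) y.
Proof.
elim/last_ind: hs2 y => [|hs2 h IH] y Vy.
  by rewrite !cats1 family_linear_last.
have [Dd Dc] := VD; rewrite -!rcons_cons -!rcons_cat.
apply: is_dirder_hausdorff (Dd _ _ _ Vy) _.
apply: (@is_dirder_near _ _ _
    (fun y => c *: D (hs1 ++ a :: hs2) y + D (hs1 ++ b :: hs2) y)).
- by rewrite IH.
- by have := near_cvg_line h oV Vy; apply: filterS => t /IH ->.
- by apply: is_dirderD; [apply: is_dirder_scaler|]; exact: Dd.
Qed.

End scalar_families.

(** * The chain rule for derivatives of all orders *)

Section faa_di_bruno.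

(* A term of an iterated derivative of a composite [f \o m] is a list of blocks
   of directions, standing for the derivative of [f] along the derivatives of
   [m] along the blocks. *)
Fixpoint grow_block (I : Type) (h : I) (bs : seq (seq I)) : seq (seq (seq I)) :=
  if bs is b :: bs' then
    (rcons b h :: bs') :: [seq b :: c | c <- grow_block h bs']
  else [::].

(** A new direction either opens a block, when the derivative of [f] is differentiated in its base
    point, or joins a block, when a derivative of [m] is differentiated. The terms thus run over the
    set partitions of the positions, as in the formula of Faa di Bruno. *)
Definition chain_terms (I : Type) (hs : seq I) : seq (seq (seq I)) :=
  foldl (fun ts h =>
    flatten [seq rcons bs [:: h] :: grow_block h bs | bs <- ts]) [:: [::]] hs.

Lemma map_grow_block (I J : Type) (k : I -> J) h bs :
  grow_block (k h) (map (map k) bs) = map (map (map k)) (grow_block h bs).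
Proof.
elim: bs => //= b bs IH; rewrite map_rcons; congr (_ :: _).
by rewrite IH -!map_comp.
Qed.

(** The terms depend on positions only, so they can be formed from indices when the directions move
    along a filter. *)
Lemma map_chain_terms (I J : Type) (k : I -> J) hs :
  chain_terms (map k hs) = map (map (map k)) (chain_terms hs).
Proof.
elim/last_ind: hs => // hs h IH.
rewrite map_rcons /chain_terms !foldl_rcons -!/(chain_terms _) IH.
rewrite map_flatten -!map_comp; congr flatten; apply: eq_map => bs /=.
by rewrite map_rcons map_grow_block.
Qed.

End faa_di_bruno.

Section chain_rule.
Context {R : realType} {E F : tvsType R}.
Context {U : set E} {V : set F} {m : seq E -> E -> F} {f : seq F -> F -> R^o}.
Hypotheses (oV : open V) (Um : smooth_family U m) (Vf : smooth_family V f).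
Hypothesis UV : forall x, U x -> V (m [::] x).

Let term (bs : seq (seq E)) (x : E) : R^o := f [seq m b x | b <- bs] (m [::] x).

Let m_cvg b h x : U x -> m b (x + t *: h) @[t --> (0 : R)^'] --> m b x.
Proof.
move=> Ux; have [_ mc] := Um.
have := mc E R (0 : R)^' b (fun i _ => i) id _ x _ Ux (@dnbhs_cvg_line _ _ x h)
  (fun _ => cvg_cst _).
by rewrite !map_id; exact.
Qed.

(** With the base point of [f] already moved, the slots are moved one at a time; those of [A] have
    been moved before. Linearity in a slot turns its increment into the value of [f] at a difference
    quotient of [m]. *)
Let slots_dirder A bs h x : U x ->
  t^-1 *: (f [seq m b (x + t *: h) | b <- A ++ bs] (m [::] (x + t *: h)) -
    f ([seq m b (x + t *: h) | b <- A] ++ [seq m b x | b <- bs])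
      (m [::] (x + t *: h))) @[t --> (0 : R)^'] -->
  (\sum_(c <- grow_block h bs) term (A ++ c) x : R^o).
Proof.
move=> Ux; have [md mc] := Um; have [fd fc] := Vf.
elim: bs A => [|b bs IH] A /=.
  rewrite big_nil; under eq_fun do rewrite map_cat cats0 subrr scaler0.
  exact: cvg_cst.
rewrite big_cons big_map.
pose q (t : R) := t^-1 *: (m b (x + t *: h) - m b x).
(* The boolean tells whether a slot has been moved; [None] is the slot that holds the difference
   quotient. *)
pose k (i : option (bool * seq E)) (t : R) : F := match i with
    | Some (true, b) => m b (x + t *: h)
    | Some (false, b) => m b x
    | None => q t
  end.
pose k0 (i : option (bool * seq E)) : F := match i with
    | Some (_, b) => m b x
    | None => m (rcons b h) x
  end.
pose s : seq (option (bool * seq E)) :=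
  [seq Some (true, b) | b <- A] ++ None :: [seq Some (false, b) | b <- bs].
have kk0 i : k i @ (0 : R)^' --> k0 i.
  case: i => [[[] c]|]; [exact: m_cvg|exact: cvg_cst|exact: md].
have := fc _ _ (0 : R)^' s k k0 _ _ _ (UV Ux) (@m_cvg [::] h x Ux) kk0.
move=> /(_ _); rewrite {}/s map_cat /= -!map_comp /= => H1.
have := IH (rcons A b) => H2.
have -> : term (A ++ rcons b h :: bs) x +
    \sum_(c <- grow_block h bs) term (A ++ b :: c) x =
    f ([seq (k0 \o (fun b => Some (true, b))) i | i <- A] ++
      m (rcons b h) x :: [seq (k0 \o (fun b => Some (false, b))) i | i <- bs])
      (m [::] x) + \sum_(c <- grow_block h bs) term (rcons A b ++ c) x.
  congr (_ + _); first by rewrite /term map_cat.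
  by apply: eq_bigr => c _; rewrite cat_rcons.
apply: cvg_near_eq; first exact: (tvs_cvgD H1 H2).
have Vm : \forall t \near (0 : R)^', V (m [::] (x + t *: h)).
  apply: (@m_cvg [::] h x Ux); apply: open_nbhs_nbhs.
  by split; [exact: oV|exact: UV].
near=> t; have t0 : t != 0 by near: t; exact: nbhs_dnbhs_neq.
have Vt : V (m [::] (x + t *: h)) by near: t.
rewrite !map_cat map_rcons !cat_rcons /= -!map_comp.
set X := f (_ ++ m b (x + t *: h) :: [seq m _ (x + t *: h) | _ <- bs]) _.
set As := map _ A; set Bs := [seq m b0 x | b0 <- bs].
have -> : f (As ++ m b (x + t *: h) :: Bs) (m [::] (x + t *: h)) =
    t *: f (As ++ q t :: Bs) (m [::] (x + t *: h)) +
    f (As ++ m b x :: Bs) (m [::] (x + t *: h)).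
  rewrite -(family_linear oV Vf)//; congr (f (_ ++ _ :: _) _).
  by rewrite /q scalerA divff// scale1r subrK.
rewrite opprD addrCA scalerDr scalerN scalerA mulVf// scale1r.
exact: addNKr.
Unshelve. all: by end_near. Qed.

(** First the base point of [f] moves, with the slots fixed: strict differentiability along the
    difference quotient of [m] gives the new block [[:: h]]. Then the slots move. *)
Lemma term_dirder bs h x : U x ->
  is_dirder (term bs) h x
    (\sum_(c <- rcons bs [:: h] :: grow_block h bs) term c x).
Proof.
move=> Ux; have [md mc] := Um; have [fd fc] := Vf.
rewrite big_cons.
pose q (t : R) := t^-1 *: (m [::] (x + t *: h) - m [::] x).
have := @family_strict _ _ _ _ oV Vf _ R (0 : R)^' bs (fun b _ => m b x)
  (fun b => m b x) (fun=> m [::] x) q id _ _ _ (UV Ux) (cvg_cst _)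
  (md [::] h x Ux) (fun _ => cvg_cst _) (@cvg_within _ _ _ _)
  (nbhs_dnbhs_neq _).
move=> /(_ _ _ _ _) H1.
have H2 := @slots_dirder [::] bs h x Ux.
rewrite /is_dirder [term (rcons _ _) _]/term map_rcons.
apply: cvg_near_eq; first exact: (tvs_cvgD H1 H2).
near=> t; have t0 : t != 0 by near: t; exact: nbhs_dnbhs_neq.
rewrite /q scalerA divff// scale1r addrCA subrr addr0.
by rewrite -scalerDr addrC addrA subrK.
Unshelve. all: by end_near. Qed.

Lemma chain_rule : smooth_family U
  (fun hs x => \sum_(bs <- chain_terms hs) f [seq m b x | b <- bs] (m [::] x)).
Proof.
have [md mc] := Um; have [fd fc] := Vf.
split=> [hs h x Ux|I T Q s k k0 a x FQ Ux ax kk0].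
  rewrite /chain_terms foldl_rcons -/(chain_terms hs) big_flatten big_map.
  by apply: is_dirder_sum => bs; exact: term_dirder.
rewrite map_chain_terms big_map.
under eq_fun do rewrite map_chain_terms big_map.
apply: tvs_cvg_sum => bs; rewrite -map_comp.
under eq_fun do rewrite -map_comp.
apply: (fc _ _ Q bs (fun b t => m [seq k i t | i <- b] (a t))
  (fun b => m [seq k0 i | i <- b] x) (fun t => m [::] (a t))).
- exact: UV.
- exact: (mc I T Q [::] k k0).
- by move=> b; exact: mc.
Qed.

End chain_rule.

(** * The real inner product of a complex Hilbert space *)

Section inner_product.
Context {R : realType} {H : hilbertType R}.
Local Notation HR := (realified R H).
Local Notation CR := (realified R R[i]^o).
Implicit Types u v w : H.

(** Expressing the inner product by norms reduces its continuity to that of the norm. *)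
Lemma inner_polarization u v : inner u v = 4^-1 *
  (`|u + v| ^+ 2 - `|u - v| ^+ 2 +
   'i * (`|u + 'i *: v| ^+ 2 - `|u - 'i *: v| ^+ 2)).
Proof.
rewrite -!inner_norm !(dnormD inner).
rewrite !(linearNl, linearNr, linearZr_LR, linearZl_LR)/= conjCi.
rewrite !rmorphN /= !rmorphM /= rmorphN /= conjCi opprK.
set d := inner u v; set d' := Num.conj d.
have i2 : 'i * 'i = -1 :> R[i] by rewrite -expr2 sqrCi.
(* The product ['i * 'i] stays visible: [field] treats ['i] as a variable, and only the first
   equality uses that its square is -1. *)
transitivity (4^-1 * (2 * (d + d') - ('i * 'i) * 2 * (d - d'))).
  by rewrite i2; field.
by field.
Qed.

Lemma continuous_inner v : continuous (inner^~ v : H -> R[i]^o).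
Proof.
have N2 w : continuous (fun u : H => `|u + w| ^+ 2 : R[i]^o).
  by move=> u; apply: cvgM; apply: cvg_norm;
    apply: cvgD; [exact: cvg_id|exact: cvg_cst|exact: cvg_id|exact: cvg_cst].
move=> u; rewrite /continuous_at inner_polarization.
under eq_fun do rewrite inner_polarization.
apply: cvgM; first exact: cvg_cst.
apply: cvgD; first by apply: cvgB; exact: N2.
by apply: cvgM; [exact: cvg_cst|apply: cvgB; exact: N2].
Qed.

Lemma continuous_Re : continuous (@complex.Re R : R[i]^o -> R^o).
Proof.
have ReB (a b : R[i]) : complex.Re (a - b) = complex.Re a - complex.Re b.
  by case: a b => [? ?] [? ?].
move=> z.
apply/(@cvgrPdist_lt _ R^o _ (nbhs (z : R[i]^o)) (nbhs_filter _)) => e e0.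
near=> w; rewrite -ltcR; apply: (@le_lt_trans _ _ `|z - w|).
  by rewrite -ReB normc_ge_Re.
near: w; apply: (@cvgr_dist_lt _ _ _ (nbhs (z : R[i]^o)) _ id z cvg_id).
by rewrite ltcR.
Unshelve. all: by end_near. Qed.

Lemma linear_Re : linear (@complex.Re R : CR -> R^o).
Proof.
move=> a [x y] [z t]; rewrite -[a *: _]/(a%:C * _) /=.
by rewrite mul0r subr0.
Qed.

(** The real part still determines the norm, and the mean value theorem applies to real
    functions. *)
Definition re_inner u v : R := complex.Re (inner u v).

Lemma re_innerC u v : re_inner u v = re_inner v u.
Proof.
have ReJ (z : R[i]) : complex.Re (Num.conj z) = complex.Re z by case: z.
by rewrite /re_inner hermC expr0 mul1r; exact: ReJ.
Qed.

Lemma re_inner_linear v : linear ((re_inner^~ v) : HR -> R^o).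
Proof.
move=> a u w; rewrite /re_inner -[a *: u]/(a%:C *: (u : H)).
rewrite linearDl linearZl_LR; exact: linear_Re.
Qed.

Lemma re_innerBl u w v : re_inner (u - w) v = re_inner u v - re_inner w v.
Proof.
have /= := re_inner_linear v (-1) w u; rewrite !scaleN1r => H1.
by rewrite [u - w]addrC [RHS]addrC; exact: H1.
Qed.

Lemma re_innerBr u w v : re_inner v (u - w) = re_inner v u - re_inner v w.
Proof. by rewrite !(re_innerC v) re_innerBl. Qed.

Lemma re_innerZl (a : R) u v : re_inner (a *: (u : HR)) v = a * re_inner u v.
Proof.
have := re_inner_linear v a u (0 : HR); rewrite addr0 => ->.
by have := re_innerBl u u v; rewrite !subrr => ->; rewrite addr0.
Qed.

Lemma re_innerZr (a : R) u v : re_inner v (a *: (u : HR)) = a * re_inner v u.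
Proof. by rewrite re_innerC re_innerZl re_innerC. Qed.

Lemma continuous_re_inner v : continuous ((re_inner^~ v) : HR -> R^o).
Proof.
move=> u; apply: (cvg_comp (inner^~ v : H -> R[i]^o) (@complex.Re R)).
  exact: continuous_inner.
exact: continuous_Re.
Qed.

Lemma re_inner_norm u : (re_inner u u)%:C = `|u| ^+ 2.
Proof.
rewrite /re_inner inner_norm RRe_real//.
by apply: ger0_real; exact: exprn_ge0.
Qed.

Lemma re_inner_lt u (e : R) : 0 < e ->
  (`|u| < e%:C) = (re_inner u u < e ^+ 2).
Proof.
move=> e0; rewrite -ltcR re_inner_norm rmorphXn/= ltr_sqr//.
  by rewrite nnegrE normr_ge0.
by rewrite nnegrE ler0c ltW.
Qed.

Lemma cvg_re_inner (T : Type) (Q : set_system T) (FQ : Filter Q) (f : T -> H)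
    (l : H) :
  re_inner (f t - l) (f t - l) @[t --> Q] --> (0 : R) -> f @ Q --> l.
Proof.
move=> fl; apply/cvgrPdist_lt => e e0.
(* The norm of [H] takes values in [R[i]], whose positive elements are real. *)
have eE : e = (complex.Re e)%:C by rewrite RRe_real// gtr0_real.
have e0' : 0 < complex.Re e by rewrite -ltcR -eE.
have /cvgrPdist_lt/(_ _ (exprn_gt0 2 e0')) := fl.
apply: filterS => t; rewrite sub0r normrN distrC eE re_inner_lt//.
exact/le_lt_trans/ler_norm.
Qed.

Lemma linear_inner v : linear (inner^~ v : HR -> CR).
Proof.
move=> a u w; rewrite -[a *: u]/(a%:C *: (u : H)) linearDl linearZl_LR.
by [].
Qed.

End inner_product.

(** * Maps into a Hilbert space with a smooth kernel *)

Section partial_derivatives.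
Context {R : realType} {E E' F : tvsType R}.

Lemma is_dirder_fst (f : E * E' -> F) h x y l :
  is_dirder f (h, 0) (x, y) l -> is_dirder (fun z => f (z, y)) h x l.
Proof.
move=> fl; apply: cvg_near_eq; first exact: fl.
near=> t; rewrite [(x, y) + _](_ : _ = (x + t *: h, y))//.
by rewrite -[RHS]/(x + t *: h, y); congr (_, _); rewrite /= scaler0 addr0.
Unshelve. all: by end_near. Qed.

Lemma is_dirder_snd (f : E * E' -> F) h x y l :
  is_dirder f (0, h) (x, y) l -> is_dirder (fun z => f (x, z)) h y l.
Proof.
move=> fl; apply: cvg_near_eq; first exact: fl.
near=> t; rewrite [(x, y) + _](_ : _ = (x, y + t *: h))//.
by rewrite -[RHS]/(x, y + t *: h); congr (_, _); rewrite /= scaler0 addr0.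
Unshelve. all: by end_near. Qed.

End partial_derivatives.

Section interleave.
Context {R : realType} {E : tvsType R}.

(** Derivatives in the two variables alternate, so that raising the order by one appends exactly the
    two directions of a mixed second derivative. *)
Definition interleave (hs ks : seq E) : seq (E * E) :=
  flatten [seq [:: (p.1, 0); (0, p.2)] | p <- zip hs ks].

Lemma interleave_rcons hs ks h k : size hs = size ks ->
  interleave (rcons hs h) (rcons ks k) =
  rcons (rcons (interleave hs ks) (h, 0)) (0, k).
Proof.
move=> hk; rewrite /interleave zip_rcons// map_rcons flatten_rcons.
by rewrite -!cats1 -catA.
Qed.

(** Indexing the alternating directions by [bool * I] lets the continuity clause of [smooth_family]
    apply to them. *)
Definition interleaved (I : Type) (f g : I -> E) (i : bool * I) : E * E :=
  if i.1 then (f i.2, 0) else (0, g i.2).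

Lemma interleave_map (I : Type) (s : seq I) (f g : I -> E) :
  interleave [seq f i | i <- s] [seq g i | i <- s] =
  [seq interleaved f g i |
    i <- flatten [seq [:: (true, i); (false, i)] | i <- s]].
Proof. by rewrite /interleave; elim: s => //= i s ->. Qed.

End interleave.

Section kernel.
Context {R : realType} {E : tvsType R} {H : hilbertType R}.
Local Notation HR := (realified R H).
Implicit Types g : E -> HR.

Lemma double_MVT (k k1 k2 : E * E -> R^o) (x y u v : E) (V : set (E * E)) :
  (forall p, V p -> is_dirder k (u, 0) p (k1 p)) ->
  (forall p, V p -> is_dirder k1 (0, v) p (k2 p)) ->
  (forall s r : R, 0 <= s <= 1 -> 0 <= r <= 1 -> V (x + s *: u, y + r *: v)) ->
  exists s r : R, [/\ 0 <= s <= 1, 0 <= r <= 1 &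
    k (x + u, y + v) - k (x, y + v) - (k (x + u, y) - k (x, y)) =
    k2 (x + s *: u, y + r *: v)].
Proof.
move=> kk1 k1k2 VP.
have i0 : 0 <= (0 : R) <= 1 by rewrite lexx ler01.
have i1 : 0 <= (1 : R) <= 1 by rewrite lexx ler01.
(* The first variable comes first, for the difference of [k] at heights [y + v] and [y]; the
   transports rewrite these heights as [y + 1 *: v] and [y + 0 *: v]. *)
have [s s01] := @dir_MVT R E (fun z => k (z, y + v) + (-1) *: k (z, y))
  (fun s => k1 (x + s *: u, y + v) + (-1) *: k1 (x + s *: u, y)) x u
  (fun s s01 => is_dirderD
     (is_dirder_fst (kk1 _ (eq_ind _ (fun w => V (_, y + w))
        (VP s 1 s01 i1) _ (scale1r v))))
     (is_dirder_scaler (is_dirder_fst (kk1 _ (eq_ind _ (fun w => V (_, w))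
        (VP s 0 s01 i0) _ (etrans (congr1 (+%R y) (scale0r v)) (addr0 y))))))).
have [r r01] := @dir_MVT R E (fun z => k1 (x + s *: u, z))
  (fun r => k2 (x + s *: u, y + r *: v)) y v
  (fun r r01 => is_dirder_snd (k1k2 _ (VP s r s01 r01))).
move=> rE sE; exists s, r; split=> //; rewrite -rE.
move: sE; rewrite !scaleN1r => <-.
by rewrite !opprB addrACA [RHS]addrACA [- _ - _]addrC.
Qed.

Lemma dirder_exists (g : E -> HR) (U : set E) (k k1 k2 : E * E -> R^o) h x :
  open U -> U x ->
  (forall y z, U y -> U z -> k (y, z) = re_inner (g y) (g z)) ->
  (forall p, (U `*` U) p -> is_dirder k (h, 0) p (k1 p)) ->
  (forall p, (U `*` U) p -> is_dirder k1 (0, h) p (k2 p)) ->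
  {for (x, x), continuous k2} ->
  exists l, is_dirder g h x l.
Proof.
move=> oU Ux kg kk1 k1k2 k2c.
pose q (t : R) : HR := t^-1 *: (g (x + t *: h) - g x).
pose L := k2 (x, x).
have bnd1 : 0 <= (1 : R) <= 1 by rewrite lexx ler01.
(* The inner product of [q t] and [q s] is a mixed second difference quotient of [k], hence a value
   of [k2] near [(x, x)]; [t] and [s] tend to 0 independently. *)
have key (e : R) : 0 < e -> exists2 d : R, 0 < d & forall t s : R,
    t != 0 -> s != 0 -> `|t| < d -> `|s| < d ->
    `|re_inner (q t) (q s) - L| < e.
  move=> e0.
  have line : (fun t : R => x + t *: h) @ (0 : R) --> x.
    by apply: (tvs_cvg_line (cvg_cst x) (cvg_cst h)); exact: cvg_id.
  have UUx : nbhs (x, x) (U `*` U).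
    by exists (U, U) => //=; split; exact: open_nbhs_nbhs.
  have /cvgrPdist_lt/(_ e e0) k2e := k2c.
  have : \forall p \near ((0 : R), (0 : R)),
     (U `*` U) (x + p.1 *: h, x + p.2 *: h) /\
     `|L - k2 (x + p.1 *: h, x + p.2 *: h)| < e.
    have c2 : (fun p : R * R => (x + p.1 *: h, x + p.2 *: h)) @
        ((0 : R), (0 : R)) --> (x, x).
      apply: cvg_pair; first exact: cvg_comp cvg_fst line.
      exact: cvg_comp cvg_snd line.
    exact: (c2 _ (filterI UUx k2e)).
  move=> [[A B] /= [/nbhs_ballP[a /= a0 aA] /nbhs_ballP[b /= b0 bB]] ABP].
  exists (Num.min a b); first by rewrite lt_min a0 b0.
  move=> t s t0 s0; rewrite !lt_min => /andP[ta tb] /andP[sa sb].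
  have ABP' (c d : R) : 0 <= c <= 1 -> 0 <= d <= 1 ->
     (U `*` U) (x + c *: (t *: h), x + d *: (s *: h)) /\
     `|L - k2 (x + c *: (t *: h), x + d *: (s *: h))| < e.
    move=> /andP[c0 c1] /andP[d0 d1]; rewrite !scalerA.
    apply: (ABP (c * t, d * s)); split=> /=.
      apply: aA; rewrite /ball/= sub0r normrN normrM (ger0_norm c0).
      by apply: le_lt_trans ta; rewrite ler_piMl.
    apply: bB; rewrite /ball/= sub0r normrN normrM (ger0_norm d0).
    by apply: le_lt_trans sb; rewrite ler_piMl.
  have k1' p : (U `*` U) p ->
      is_dirder k (t *: h, 0) p (t *: k1 p : R^o).
    move=> /kk1 /is_dirderZ kp; have := kp t.
    by rewrite [t *: _](_ : _ = (t *: h, 0))//; congr pair; rewrite /= scaler0.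
  have k2' p : (U `*` U) p ->
      is_dirder (fun p => t *: k1 p : R^o) (0, s *: h) p
        (s *: (t *: k2 p) : R^o).
    move=> /k1k2 kp; have := is_dirderZ (c := s) (is_dirder_scaler (c := t) kp).
    rewrite [s *: (0, h)](_ : _ = (0, s *: h))//.
    by congr pair; rewrite /= scaler0.
  have [c [d [c01 d01]]] :=
    double_MVT k1' k2' (fun c d c01 d01 => (ABP' c d c01 d01).1).
  have Uth : U (x + t *: h).
    by have [[+ _] _] := ABP' 1 1 (bnd1) (bnd1); rewrite /= scale1r.
  have Ush : U (x + s *: h).
    by have [[_ +] _] := ABP' 1 1 (bnd1) (bnd1); rewrite /= scale1r.
  rewrite !kg// => kE.
  have -> : re_inner (q t) (q s) = k2 (x + c *: (t *: h), x + d *: (s *: h)).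
    rewrite /q re_innerZl re_innerZr !re_innerBl !re_innerBr.
    have -> (a1 a2 a3 a4 : R) : a1 - a2 - (a3 - a4) = a1 - a3 - (a2 - a4).
      by ring.
    by rewrite kE -[s *: _]/(s * (t * _)) mulKf// mulKf.
  rewrite distrC; exact: (ABP' c d c01 d01).2.
pose F : set_system H := (q : R -> H) @ (0 : R)^'.
have cF : cauchy F.
  apply: cauchy_exP => e e0.
  have eE : e = (complex.Re e)%:C by rewrite RRe_real// gtr0_real.
  have e0' : 0 < complex.Re e by rewrite -ltcR -eE.
  (* The squared distance of [q t] and [q (d / 2)] expands into four inner products, each within
     this bound of [L]; the copies of [L] cancel. The center [d / 2] is just a fixed nonzero
     parameter below [d]. *)
  have e4 : 0 < complex.Re e ^+ 2 / 4 by rewrite divr_gt0// exprn_gt0.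
  have [d d0 dP] := key _ e4.
  have d2 : 0 < d / 2 by rewrite divr_gt0.
  exists (q (d / 2)); rewrite /F/=.
  near=> t.
  rewrite -ball_normE/= eE re_inner_lt//.
  have d2d : `|d / 2| < d by rewrite gtr0_norm// ltr_pdivrMr// ltr_pMr// ltr1n.
  have t0 : t != 0 by near: t; exact: nbhs_dnbhs_neq.
  have td : `|t| < d by near: t; apply: dnbhs0_lt.
  have sn0 : d / 2 != 0 by rewrite gt_eqF.
  have := dP _ _ t0 t0 td td; have := dP _ _ t0 sn0 td d2d.
  have := dP _ _ sn0 sn0 d2d d2d.
  rewrite re_innerBl !re_innerBr [re_inner (q (d / 2)) (q t)]re_innerC.
  rewrite !ltr_norml => /andP[? ?] /andP[? ?] /andP[? ?]; lra.
have /cauchy_cvg/cvg_ex[l Fl] := cF.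
by exists l.
Unshelve. all: by end_near. Qed.
End kernel.

Section kernel_smooth.
Context {R : realType} {E : tvsType R} {H : hilbertType R}.
Local Notation HR := (realified R H).
Variables (g : E -> HR) (U : set E) (K : seq (E * E) -> E * E -> R^o).
Hypotheses (oU : open U) (UK : smooth_family (U `*` U) K).
Hypothesis Kg : forall x y, U x -> U y -> K [::] (x, y) = re_inner (g x) (g y).

Let kernel_at n := forall hs ks x y, size hs = n -> size ks = n -> U x -> U y ->
  K (interleave hs ks) (x, y) = re_inner (dirders g hs x) (dirders g ks y).

(** The kernel of the derivative along [hs] is the member of [K] at the interleaved list, and its
    mixed derivative along [h] is again a member; so the existence criterion for derivatives
    applies. *)
Let exists_step n hs h x : kernel_at n -> size hs = n -> U x ->
  is_dirder (dirders g hs) h x (dirders g (rcons hs h) x).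
Proof.
move=> IH sn Ux; have [Kd Kc] := UK.
rewrite /dirders foldl_rcons -/(dirders g hs) /dirder.
apply: (xgetPex 0); rewrite -/(is_dirder _ _ _ _).
pose il := interleave hs hs.
apply: (@dirder_exists _ _ _ _ U (K il) (K (rcons il (h, 0)))
  (K (rcons (rcons il (h, 0)) (0, h)))) => //.
- by move=> y z Uy Uz; exact: IH.
- by move=> p; exact: Kd.
- by move=> p; exact: Kd.
- set s := rcons _ _.
  have := Kc _ _ (nbhs (x, x)) s (fun i _ => i) id id (x, x) _ (conj Ux Ux)
    cvg_id (fun _ => cvg_cst _).
  by move=> /(_ _ _); rewrite !map_id; exact.
Qed.

(** The identity of order [n] gives the existence of the next derivatives of [g]; it is then
    differentiated once in each variable through the continuous linear functionals
    [re_inner^~ w]. *)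
Lemma kernel_dirders n : kernel_at n.
Proof.
have [Kd Kc] := UK.
elim: n => [|n IH] hs ks x y.
  by move=> /size0nil -> /size0nil ->; exact: Kg.
elim/last_ind: hs => // hs h _; elim/last_ind: ks => // ks k _.
rewrite !size_rcons => -[hn] [kn] Ux Uy.
rewrite interleave_rcons ?hn//.
have step1 z : U z -> K (rcons (interleave hs ks) (h, 0)) (x, z) =
    re_inner (dirders g (rcons hs h) x) (dirders g ks z).
  move=> Uz; have /is_dirder_fst Kx :=
    Kd (interleave hs ks) (h, 0) (x, z) (conj Ux Uz).
  apply: is_dirder_hausdorff Kx _.
  apply: (@is_dirder_near _ _ _
      (fun z' => re_inner (dirders g hs z') (dirders g ks z) : R^o)).
  - by rewrite IH.
  - have := near_cvg_line h oU Ux; apply: filterS => t Ut.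
    by rewrite IH.
  exact: (is_dirder_linear (re_inner_linear (dirders g ks z))
    (@continuous_re_inner _ _ (dirders g ks z)) (exists_step IH hn Ux)).
have /is_dirder_snd Kx := Kd (rcons (interleave hs ks) (h, 0)) (0, k) (x, y)
  (conj Ux Uy).
apply: is_dirder_hausdorff Kx _.
apply: (@is_dirder_near _ _ _
    (fun z => re_inner (dirders g ks z) (dirders g (rcons hs h) x) : R^o)).
- by rewrite step1// re_innerC.
- have := near_cvg_line k oU Uy; apply: filterS => t Ut.
  by rewrite step1// re_innerC.
rewrite [re_inner _ _]re_innerC.
exact: (is_dirder_linear (re_inner_linear (dirders g (rcons hs h) x))
  (@continuous_re_inner _ _ (dirders g (rcons hs h) x)) (exists_step IH kn Uy)).
Qed.

Theorem kernel_smooth_on : smooth_on U g.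
Proof.
have [Kd Kc] := UK.
split=> [hs h x Ux|j [x b]].
  exists (dirders g (rcons hs h) x).
  by apply: (exists_step (@kernel_dirders (size hs))).
rewrite inE => -[/= Ux _]; apply: cvg_re_inner => /=.
set s := enum 'I_j.
set hs0 := [seq b 0 i | i <- s].
have sizeE (w : 'I_j -> E) : size [seq w i | i <- s] = j.
  by rewrite size_map size_enum_ord.
have fstx : (fun p : E * 'rV[E]_j => p.1) @ nbhs (x, b) --> x.
  exact: (@cvg_fst _ _ (nbhs x) (nbhs b)).
have coordb i : (fun p : E * 'rV[E]_j => p.2 0 i) @ nbhs (x, b) --> b 0 i.
  apply: (cvg_comp snd (fun M : 'rV[E]_j => M 0 i)).
    exact: (@cvg_snd _ _ (nbhs x) (nbhs b)).
  exact: mx_coord_continuous.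
(* Points and directions may vary or stay fixed separately in the two variables of the kernel; the
   limit is the same in all cases. *)
have Kcvg (u v : E * 'rV[E]_j -> 'I_j -> E) (y z : E * 'rV[E]_j -> E) :
    (forall i, u^~ i @ nbhs (x, b) --> b 0 i) ->
    (forall i, v^~ i @ nbhs (x, b) --> b 0 i) ->
    y @ nbhs (x, b) --> x -> z @ nbhs (x, b) --> x ->
    K (interleave [seq u p i | i <- s] [seq v p i | i <- s]) (y p, z p)
      @[p --> nbhs (x, b)] --> K (interleave hs0 hs0) (x, x).
  move=> ub vb yx zx; rewrite interleave_map.
  under eq_fun do rewrite interleave_map.
  apply: (Kc _ _ (nbhs (x, b)) _ (fun i p => interleaved (u p) (v p) i)
    (interleaved (b 0) (b 0)) (fun p => (y p, z p))) => //.
    exact: cvg_pair.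
  move=> [[] i]; rewrite /interleaved/=;
    by apply: cvg_pair => //; exact: cvg_cst.
have cst i : (fun _ : E * 'rV[E]_j => b 0 i) @ nbhs (x, b) --> b 0 i.
  exact: cvg_cst.
have cstx : (fun _ : E * 'rV[E]_j => x) @ nbhs (x, b) --> x by exact: cvg_cst.
have K1 := Kcvg (fun p => p.2 0) (fun p => p.2 0) _ _ coordb coordb fstx fstx.
have K2 := Kcvg (fun p => p.2 0) (fun=> b 0) _ _ coordb cst fstx cstx.
(* These are the four terms of the squared distance between the derivative at the moving data and at
   the limit; they have a common limit and cancel. *)
have := tvs_cvgB (tvs_cvgB K1 K2)
  (tvs_cvgB K2 (cvg_cst (K (interleave hs0 hs0) (x, x)))).
rewrite !subrr => lim0; apply: cvg_near_eq; first exact: lim0.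
have : \forall p \near (x, b), U p.1 by apply: fstx; exact: open_nbhs_nbhs.
apply: filterS => p Up.
rewrite !(@kernel_dirders j) ?sizeE// re_innerBl !re_innerBr.
by rewrite [re_inner (dirders g hs0 x) (dirders g [seq _ | _ <- _] _)]re_innerC.
Qed.

End kernel_smooth.

(** * Locality of smoothness and constructions of families *)

Section family_constructions.
Context {R : realType}.
Implicit Types E F : tvsType R.

(** Both clauses of [smooth_on] are conditions at single points, and [dirders] does not depend on
    the set. *)
Lemma smooth_on_local E F (U : set E) (f : E -> F) :
  (forall x, U x -> exists2 W, W x & smooth_on W f) -> smooth_on U f.
Proof.
move=> loc; split=> [hs h x Ux|j [x b]].
  by have [W Wx [fd _]] := loc x Ux; exact: fd.
rewrite inE => -[/= Ux _]; have [W Wx [_ fc]] := loc x Ux.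
by apply: fc; rewrite inE.
Qed.

Lemma smooth_family_sub E F (U W : set E) (D : seq E -> E -> F) :
  W `<=` U -> smooth_family U D -> smooth_family W D.
Proof.
move=> WU [Dd Dc].
by split=> [hs h x /WU|I T Q s k k0 a x FQ /WU]; [exact: Dd|exact: Dc].
Qed.

Lemma smooth_family_precomp E E' F (U : set E) (D : seq E -> E -> F)
    (A : E' -> E) :
  linear A -> continuous A -> smooth_family U D ->
  smooth_family (A @^-1` U) (fun hs x => D (map A hs) (A x)).
Proof.
move=> lA cA [Dd Dc]; split=> [hs h x Ux|I T Q s k k0 a x FQ Ux ax kk0].
  rewrite map_rcons /is_dirder.
  have AE t : A (x + t *: h) = A x + t *: A h by rewrite addrC lA addrC.
  by under eq_fun do rewrite AE; exact: Dd.
rewrite -map_comp; under eq_fun do rewrite -map_comp.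
apply: (Dc _ _ Q s (fun i => A \o k i) (A \o k0) (A \o a)) => //.
  exact: (cvg_comp _ _ ax (cA _)).
by move=> i; exact: (cvg_comp _ _ (kk0 i) (cA _)).
Qed.

Lemma smooth_family_pair E F F' (U : set E) (D : seq E -> E -> F)
    (D' : seq E -> E -> F') : smooth_family U D -> smooth_family U D' ->
  smooth_family U (fun hs x => (D hs x, D' hs x)).
Proof.
move=> [Dd Dc] [Dd' Dc'].
split=> [hs h x Ux|I T Q s k k0 a x FQ Ux ax kk0].
  exact: (cvg_pair (Dd hs h x Ux) (Dd' hs h x Ux)).
apply: cvg_pair; [exact: Dc|exact: Dc'].
Qed.

Definition id_family E (hs : seq E) (x : E) : E :=
  match hs with [::] => x | [:: h] => h | _ => 0 end.

Lemma smooth_family_id E (U : set E) : smooth_family U (@id_family E).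
Proof.
split=> [hs h x Ux|I T Q s k k0 a x FQ Ux ax kk0]; last first.
  by case: s => [|i [|i' s]] //=; exact: cvg_cst.
case: hs => [|h1 hs] /=.
  apply: cvg_near_eq; first exact: (cvg_cst h).
  near=> t; rewrite addrC addKr scalerA mulVf ?scale1r//.
  by near: t; exact: nbhs_dnbhs_neq.
rewrite /is_dirder (_ : (fun _ => _) = fun=> 0).
  by case: hs => [|h2 hs] /=; exact: cvg_cst.
by apply/funext => t; case: hs => [|h2 hs]; rewrite /= subrr scaler0.
Unshelve. all: by end_near. Qed.

End family_constructions.

(** * Images of open sets under charts *)

Section charts.
Context {R : realType} {E : tvsType R} {M : topologicalType}.
Implicit Types (c : chart E M) (A : set M).

Lemma chart_invK c x : (c @` chart_dom c) x ->
  chart_dom c (chart_inv c x) /\ c (chart_inv c x) = x.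
Proof. by move=> [a ca <-]; rewrite chart_mapK//; exact: mem_set. Qed.

(** Inside the open image of the chart, the image of [A] is the preimage of [A] under the continuous
    inverse. *)
Lemma open_chart_image c A : open A -> A `<=` chart_dom c -> open (c @` A).
Proof.
move=> oA Ac; rewrite openE => x [a Aa ax].
have cx : (c @` chart_dom c) x by exists a => //; exact: Ac.
have inv_cvg : chart_inv c y @[y --> x] --> a.
  have <- : chart_inv c x = a by rewrite -ax chart_mapK//; exact/mem_set/Ac.
  by apply: chart_inv_continuous; exact: mem_set.
have xA : \forall y \near x, A (chart_inv c y).
  by apply: inv_cvg; exact: open_nbhs_nbhs.
have xc : \forall y \near x, (c @` chart_dom c) y.
  by apply: open_nbhs_nbhs; split=> //; exact: open_chart_img.
apply: filterS2 xA xc => y Ay /chart_invK[_ yE].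
by exists (chart_inv c y).
Qed.

End charts.

(** * Orbit maps and matrix coefficients of a unitary representation *)

Section unitary.
Context {R : realType} {E : tvsType R} {G : lieGroupType E} {H : hilbertType R}.
Variables (pi : unitary_rep G H) (v : H).

Lemma rep_kernel g h :
  re_inner (pi g v) (pi h v) = re_inner (pi (h^-1 * g)%g v) v.
Proof.
have [_ pi_inner] := rep_unitary pi h.
by rewrite -{1}[g](mulVKg h) repM /re_inner/= pi_inner.
Qed.

(** The coefficient is the orbit map followed by a continuous real-linear map. *)
Lemma smooth_vector_matrix_coef w : smooth_vector pi v ->
  smooth_map_on lie_atlas (id_atlas _) setT (matrix_coef pi v w).
Proof.
move=> [vc vs]; split.
  move=> g _; apply: (cvg_comp (orbit_map pi v) (inner^~ w : H -> R[i]^o)).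
    by apply: vc; rewrite inE.
  exact: continuous_inner.
move=> c _ Ac ->; have {vs} := vs c _ Ac erefl.
rewrite /id_chart/= !preimage_setT setIT setTI => /smooth_on_family vs.
have Lvs := smooth_family_linear (linear_inner w) _ vs.
apply: (family_smooth_on _ _ _ (Lvs _)) => //.
- by apply: open_chart_image => //; exact: open_chart_dom.
- exact: continuous_inner.
Qed.

Lemma mulg_continuous : continuous (fun p : G * G => (p.1 * p.2)%g).
Proof. by move=> p; apply: (@lie_mul_smooth R E G).1; rewrite inE. Qed.

Lemma invg_continuous : continuous (fun g : G => g^-1%g).
Proof. by move=> p; apply: (@lie_inv_smooth R E G).1; rewrite inE. Qed.

Lemma cvg_mulVg (T : Type) (Q : set_system T) (FQ : Filter Q) (a b : T -> G)
    (g h : G) :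
  a @ Q --> g -> b @ Q --> h -> ((b t)^-1 * a t)%g @[t --> Q] --> (h^-1 * g)%g.
Proof.
move=> ag bh.
have bV : (fun t => (b t)^-1%g) @ Q --> (h^-1)%g.
  apply: (cvg_comp b (fun h : G => h^-1%g)); first exact: bh.
  exact: (@invg_continuous h).
apply: (cvg_comp (fun t => ((b t)^-1%g, a t)) (fun p : G * G => (p.1 * p.2)%g)).
  exact: (cvg_pair bV ag).
exact: (@mulg_continuous (h^-1, g)%g).
Qed.

Variable U : set G.
Hypotheses (U1 : open_nbhs 1%g U).
Hypothesis phi_smooth :
  smooth_map_on lie_atlas (id_atlas _) U (matrix_coef pi v v).

(** The squared distance of [pi g v] and [pi g0 v] is twice the real part of the coefficient at 1
    minus that at [g0^-1 * g], so continuity of the coefficient at 1 suffices. *)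
Lemma orbit_map_continuous : continuous (orbit_map pi v).
Proof.
move=> g0; apply: cvg_re_inner.
have phi_cvg : re_inner (pi (g0^-1 * g)%g v) v @[g --> g0] -->
    re_inner (pi 1%g v) v.
  apply: (cvg_comp (fun g => matrix_coef pi v v (g0^-1 * g)%g) (@complex.Re R)).
    apply: (cvg_comp (fun g => (g0^-1 * g)%g) (matrix_coef pi v v)); last first.
      by apply: phi_smooth.1; rewrite inE; exact: U1.2.
    rewrite -(mulVg g0); apply: cvg_mulVg; [exact: cvg_id|exact: cvg_cst].
  exact: continuous_Re.
have pi1 g : re_inner (pi g v) (pi g v) = re_inner (pi 1%g v) v.
  by rewrite rep_kernel mulVg.
have := tvs_cvgB (tvs_cvgB (cvg_cst (re_inner (pi 1%g v) v : R^o)) phi_cvg)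
  (tvs_cvgB phi_cvg (cvg_cst (re_inner (pi 1%g v) v : R^o))).
rewrite !subrr => lim0; apply: cvg_near_eq; first exact: lim0.
near=> g; rewrite re_innerBl !re_innerBr !pi1.
by rewrite [re_inner (pi g0 v) (pi g v)]re_innerC rep_kernel.
Unshelve. all: by end_near. Qed.

Lemma orbit_map_chart_smooth_at c x0 : lie_atlas c -> (c @` chart_dom c) x0 ->
  exists2 W, W x0 & smooth_on W (orbit_map pi v \o chart_inv c).
Proof.
move=> Ac cx0; pose g (x : E) := chart_inv c x.
have g_cvg : g @ x0 --> g x0 by apply: chart_inv_continuous; exact: mem_set.
have [atlas_cover _] := @lie_atlas_smooth R E G.
(* The kernel involves [(g y)^-1 * g x]: the chart [e] receives the inverses near [(g x0)^-1], and
   [d] the products near 1. *)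
have [e Ae e_dom] := atlas_cover (g x0)^-1%g.
have [d Ad d_dom] := atlas_cover 1%g.
pose U' := U `&` chart_dom d.
have oU' : open U' by apply: openI; [exact: U1.1|exact: open_chart_dom].
have [W oWx0 WP] : exists2 W, open_nbhs x0 W & forall x y, W x -> W y ->
    [/\ (c @` chart_dom c) x, chart_dom e (g x)^-1%g & U' ((g y)^-1 * g x)%g].
  have near_c : \forall x \near x0, (c @` chart_dom c) x.
    by apply: open_nbhs_nbhs; split=> //; exact: open_chart_img.
  have near_e : \forall x \near x0, chart_dom e (g x)^-1%g.
    have gV : (fun x => (g x)^-1%g) @ x0 --> ((g x0)^-1)%g.
      apply: (cvg_comp g (fun h : G => h^-1%g)); first exact: g_cvg.
      exact: (@invg_continuous (g x0)).
    by apply: gV; apply: open_nbhs_nbhs; split=> //; exact: open_chart_dom.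
  have gg : (fun p : E * E => (g p.2)^-1 * g p.1)%g @ (x0, x0) --> 1%g.
    rewrite -(mulVg (g x0)); apply: cvg_mulVg.
      exact: (cvg_comp _ _ (@cvg_fst _ _ (nbhs x0) (nbhs x0) _) g_cvg).
    exact: (cvg_comp _ _ (@cvg_snd _ _ (nbhs x0) (nbhs x0) _) g_cvg).
  have nU' : nbhs 1%g U'.
    by apply: open_nbhs_nbhs; split=> //; split=> //; exact: U1.2.
  have [[A B] /= [nA nB] ABP] := gg _ nU'.
  (* Both variables range over the same set, so it has to lie in both factors of the product
     neighborhood; the interior makes it open. *)
  exists (A `&` B `&` ([set x | (c @` chart_dom c) x] `&`
    [set x | chart_dom e (g x)^-1%g]))°.
    split; first exact: open_interior.
    by apply: filterI; apply: filterI.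
  move=> x y /interior_subset[[Ax _] [cx ex]] /interior_subset[[_ By] _].
  by split=> //; exact: (ABP (x, y)).
exists W; first exact: oWx0.2.
(* In the charts, the kernel at (x, y) is the matrix coefficient composed with
   [m], the product, and [N], which sends (x, y) to (y^-1, x). *)
pose I := e \o (fun g : G => g^-1%g) \o chart_inv c.
have WI : smooth_family W (dirders I).
  have := smooth_on_family (lie_inv_smooth.2 c e Ac Ae).
  apply: smooth_family_sub => x Wx; have [cx ex _] := WP x x Wx Wx.
  have [? gx] := chart_invK cx.
  by exists (g x).
pose N hs (p : E * E) :=
  (dirders I (map snd hs) p.2, id_family (map fst hs) p.1).
have WN : smooth_family (W `*` W) N.
  apply: smooth_family_pair.
    apply: (@smooth_family_sub _ _ _ (snd @^-1` W)); first by move=> p [].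
    by apply: smooth_family_precomp WI => // p; exact: cvg_snd.
  apply: (@smooth_family_sub _ _ _ (fst @^-1` setT)) => //.
  by apply: smooth_family_precomp (smooth_family_id _) => // p; exact: cvg_fst.
pose ec := prod_chart e c.
pose S := ec @` (chart_dom ec `&` [set p | U' (p.1 * p.2)%g]).
have oS : open S.
  apply: open_chart_image; last by move=> p [].
  apply: openI; first exact: open_chart_dom.
  by apply: open_comp oU' => p _; exact: mulg_continuous.
pose m := d \o (fun p : G * G => (p.1 * p.2)%g) \o chart_inv ec.
have Sm : smooth_family S (dirders m).
  have Aec : prod_atlas lie_atlas lie_atlas ec by exists e => //; exists c.
  have := smooth_on_family (lie_mul_smooth.2 ec d Aec Ad).
  by apply: smooth_family_sub => _ [p [ecp [_ dp]] <-]; exists p.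
pose V := d @` U'.
have oV : open V by apply: open_chart_image oU' _ => p [].
pose f := matrix_coef pi v v \o chart_inv d.
have Vf : smooth_family V (fun hs => @complex.Re R \o dirders f hs : E -> R^o).
  apply: smooth_family_linear; [exact: linear_Re|exact: continuous_Re|].
  have := smooth_on_family (phi_smooth.2 d (id_chart _) Ad erefl).
  by apply: smooth_family_sub => _ [p [Up dp] <-]; exists p.
have Sm' p : S p -> V (dirders m [::] p).
  move=> [q [ecq Uq] <-]; exists (q.1 * q.2)%g => //.
  by rewrite /= /m/= !chart_mapK//; apply: mem_set; case: ecq.
have WN' p : (W `*` W) p -> S (N [::] p).
  move=> [Wx Wy]; have [cx ex Uxy] := WP _ _ Wx Wy.
  have [cy ey _] := WP _ _ Wy Wy.
  have [? gx] := chart_invK cx.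
  exists ((g p.2)^-1, g p.1)%g; first by split.
  by rewrite /N /= gx.
(* The chain rule is for scalar outer functions, so the composite is associated as [f] after [m]
   first, and the scalar result after [N]. *)
have WK := chain_rule oS WN (chain_rule oV Sm Vf Sm') WN'.
apply: (kernel_smooth_on oWx0.1 WK) => x y Wx Wy.
rewrite /chain_terms /= !big_seq1 /= /f /I /m /=.
have [cx ex [_ dxy]] := WP _ _ Wx Wy; have [cy ey _] := WP _ _ Wy Wy.
have [? gx] := chart_invK cx.
rewrite [chart_inv e _]chart_mapK; last exact: mem_set.
rewrite chart_mapK; last exact: mem_set.
by rewrite /orbit_map/= rep_kernel.
Qed.

Lemma matrix_coef_smooth_vector : smooth_vector pi v.
Proof.
split=> [g _|c _ Ac ->]; first exact: orbit_map_continuous.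
rewrite /id_chart/= !preimage_setT setIT setTI.
by apply: smooth_on_local => x; exact: orbit_map_chart_smooth_at.
Qed.

End unitary.

Theorem theorem7p2 (R : realType) (E : tvsType R) (G : lieGroupType E)
    (G_exp : has_smooth_exp G) (H : hilbertType R) (pi : unitary_rep G H)
    (v : H) :
  smooth_vector pi v <->
  exists2 U : set G, open_nbhs 1%g U &
    smooth_map_on lie_atlas (id_atlas _) U (matrix_coef pi v v).
Proof.
split=> [pi_v|[U U1]]; last exact: matrix_coef_smooth_vector.
exists setT; last exact: smooth_vector_matrix_coef.
by split; first exact: openT.
Qed.
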